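(* Let $\mathcal{P}\in\mathcal{Q}_n$ be a sign singular sign pattern with signed directed graph $D$. If $\mathcal{P}\in\Delta$, then: (1) all even cycles in $D$ are nonnegative (no even cycle is negative); (2) among all $p\times q$ zero submatrices of $\mathcal{P}$, $\max(p+q)\le n+2$; (3) if $\gamma=(i_1,\dots,i_k)$ is a nonzero odd cycle in $D$, then the signed directed graph of $\mathcal{P}[\{i_1,\dots,i_k\}^c]$ has no nonzero odd cycle; (4) if $D$ has no composite cycle of length $n-1$, then all cycles in $D$ are even and nonnegative, and $D$ has a composite cycle of length $n-2$; (5) if $D$ contains a composite cycle of length $n-1$ and all composite cycles of length $n-1$ in $D$ have the same sign, then all odd cycles in $D$ have the same sign; (6) if $D$ has two composite cycles of length $n-1$ of opposite sign, then $D$ has a composite cycle of length $n-2$.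
   Context: A sign pattern is a matrix with entries in $\{+,-,0\}$; $\mathcal{Q}_n$ is the set of $n\times n$ sign patterns; $\mathcal{Q}(\mathcal{P})$ is the set of real matrices whose entries have the signs prescribed by $\mathcal{P}$. $\mathcal{P}$ is sign singular if every matrix in $\mathcal{Q}(\mathcal{P})$ is singular (all terms of the standard determinant expansion of $\mathcal{P}$ are zero). $\Delta$ is the class of all sign patterns $\mathcal{P}$ for which every $A\in\mathcal{Q}(\mathcal{P})$ has exactly two real eigenvalues (with algebraic multiplicity). $\mathcal{P}[\alpha]$ is the principal submatrix on index set $\alpha$. The signed directed graph $D$ of $\mathcal{P}=[p_{ij}]$ has vertices $1,\dots,n$ and arc $(i,j)$ (loops allowed) iff $p_{ij}\neq0$. A (nonzero) simple cycle $\gamma=(i_1,\dots,i_k)$ has distinct vertices with $p_{i_1i_2},\dots,p_{i_ki_1}$ nonzero, length $k$ (even/odd accordingly) and sign $(-1)^{k-1}p_{i_1i_2}\cdots p_{i_ki_1}$. A composite cycle is a product of mutually vertex-disjoint simple cycles; its length is the sum of their lengths and its sign the product of their signs. *)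

(* Defs.v *)
From mathcomp Require Import all_boot all_order all_algebra reals.
From mathcomp Require Import polyrcf.

Set Implicit Arguments.
Unset Strict Implicit.
Unset Printing Implicit Defensive.

Import Order.TTheory GRing.Theory Num.Theory.
Local Open Scope ring_scope.

Inductive sign := Plus | Minus | Zero.

Definition int_of_sign (s : sign) : int :=
  match s with Plus => 1 | Minus => -1 | Zero => 0 end.

Coercion int_of_sign : sign >-> int.

Notation signPattern n := 'M[sign]_n.

(* [Q(P)]; [sgz x : int] is 1, -1 or 0 according to the sign of [x]. *)
Definition qual_class (R : realType) n (P : signPattern n) (A : 'M[R]_n) : Prop :=
  forall i j, sgz (A i j) = P i j.

Definition sign_singular (R : realType) n (P : signPattern n) : Prop :=
  forall A : 'M[R]_n, qual_class P A -> A \notin unitmx.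

(* [rootsR] lists the distinct real roots, [mup] is the algebraic multiplicity. *)
Definition nb_real_eigenvalues (R : realType) n (A : 'M[R]_n) : nat :=
  (\sum_(x <- rootsR (char_poly A)) mup x (char_poly A))%N.

Definition requires_two_real_eigenvalues (R : realType) n (P : signPattern n) : Prop :=
  forall A : 'M[R]_n, qual_class P A -> nb_real_eigenvalues A = 2%N.

(* [P[a]]; its indices are numbered by [enum_val : 'I_#|a| -> 'I_n], which is
   increasing with image [a]. *)
Definition principal_sub n (P : signPattern n) (a : {set 'I_n}) : signPattern #|a| :=
  mxsub (enum_val : 'I_#|a| -> 'I_n) (enum_val : 'I_#|a| -> 'I_n) P.

Definition zero_submatrix n (P : signPattern n) (a b : {set 'I_n}) : Prop :=
  forall i j, i \in a -> j \in b -> P i j = Zero.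

(* The arcs of the signed digraph of [P]; the sign of the arc (i, j) is [P i j]. *)
Definition arc n (P : signPattern n) : rel 'I_n := fun i j => (P i j : int) != 0.

(* A cycle (i_1, ..., i_k), k >= 1, is the sequence of its vertices, with any
   choice of the starting vertex; for k = 1 it is a loop. *)
Definition simple_cycle n (P : signPattern n) (c : seq 'I_n) : bool :=
  [&& c != [::], uniq c & cycle (arc P) c].

Definition cycle_sign n (P : signPattern n) (c : seq 'I_n) : int :=
  (-1) ^+ (size c).-1 * \prod_(i <- c) (P i (next c i) : int).

(* A single simple cycle is a composite cycle, and so is the empty product,
   of length 0 and sign 1. *)
Definition composite_cycle n (P : signPattern n) (C : seq (seq 'I_n)) : bool :=
  all (simple_cycle P) C && pairwise (fun c d => [disjoint c & d]) C.

Definition composite_length n (C : seq (seq 'I_n)) : nat :=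
  (\sum_(c <- C) size c)%N.

Definition composite_sign n (P : signPattern n) (C : seq (seq 'I_n)) : int :=
  \prod_(c <- C) cycle_sign P c.

(* Main.v *)
(** Up to sign, the coefficient of [X^(n-k)] in the characteristic polynomial is
    the sum of the signed weights of the composite cycles of length [k].
    Conversely, letting the entries of [A] off a composite cycle [C] tend to 0,
    the characteristic polynomial tends to
    [X^(n-|C|) * \prod_(c in C) (X^|c| - w(c))], with [w(c)] the product of the
    entries along [c], so simple real roots and nonzero coefficients of that limit
    persist in [Q(P)]. As 0 is always an eigenvalue, a negative even cycle
    (roots near 1 and -1) or two disjoint odd cycles (roots near [a] and [2b] with
    [a, b] = 1 or -1) would give three real eigenvalues, and so would a [p x q] zero
    submatrix with [p + q > n + 2], which makes 0 a triple root. The only other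
    real eigenvalue has the sign opposite to that of the coefficient of [X],
    whereas an odd cycle realizes an eigenvalue of its own sign: this gives (5).
    If the coefficient of [X] vanishes, identically in (4) or by the intermediate
    value theorem in (6), then 0 is exactly a double root and the coefficient of
    [X^2] is nonzero. *)

Require Import Defs.
From mathcomp Require Import lra zify.
From mathcomp Require Import all_boot all_order all_algebra fingroup perm reals.
From mathcomp Require Import polyrcf.

Set Implicit Arguments.
Unset Strict Implicit.
Unset Printing Implicit Defensive.

Import Order.TTheory GRing.Theory Num.Theory.
Local Open Scope ring_scope.

(** * Real roots of polynomials *)

Lemma size_le_sum_count (T : eqType) (s r : seq T) :
  {subset s <= r} -> (size s <= \sum_(x <- r) count_mem x s)%N.
Proof.
elim: s => //= y s IHs sub_r.
rewrite big_split /= -add1n leq_add ?IHs //; last first.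
  by move=> x sx; apply: sub_r; rewrite inE sx orbT.
have -> : (\sum_(x <- r) (y == x) = count_mem y r)%N.
  rewrite -sum1_count [RHS]big_mkcond; apply: eq_bigr => x _ /=.
  by rewrite eq_sym; case: eqP.
by rewrite -has_count has_pred1 sub_r ?mem_head.
Qed.

(** Divisibility makes each value occur in [s] at most as often as it is a root, and summing over
    the distinct roots bounds the length. Repeated entries of [s] thus account for
    multiplicities. *)
Lemma size_le_nb_real_eigenvalues (R : realType) n (A : 'M[R]_n) (s : seq R) :
  \prod_(x <- s) ('X - x%:P) %| char_poly A ->
  (size s <= nb_real_eigenvalues A)%N.
Proof.
move=> s_dvd; have pN0 := monic_neq0 (char_poly_monic A).
have sN0 : \prod_(x <- s) ('X - x%:P) != 0 by rewrite monic_neq0 ?monic_prod_XsubC.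
apply: leq_trans (_ : _ <= \sum_(x <- rootsR (char_poly A)) count_mem x s)%N _.
  apply: size_le_sum_count => x sx; rewrite -roots_on_rootsR // in_itv /=.
  rewrite -dvdp_XsubCl; apply: dvdp_trans s_dvd.
  by rewrite dvdp_XsubCl root_prod_XsubC.
apply: leq_sum => x _; rewrite mup_geq //; apply: dvdp_trans s_dvd.
by rewrite -mup_geq // mu_prod_XsubC.
Qed.

Lemma polyX_dvd (F : fieldType) (p : {poly F}) k :
  (forall i, (i < k)%N -> p`_i = 0) -> 'X^k %| p.
Proof.
move=> p0; rewrite -[p](poly_take_drop k).
have -> : take_poly k p = 0.
  by apply/polyP=> i; rewrite coef_take_poly coef0; case: ifP => // /p0.
by rewrite add0r dvdp_mulIr.
Qed.

(** Without roots the polynomial keeps everywhere its sign at plus infinity, that of its leading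
    coefficient 1. *)
Lemma monic_no_root_gt0 (R : rcfType) (p : {poly R}) :
  p \is monic -> (forall x, ~~ root p x) -> forall x, 0 < p.[x].
Proof.
move=> p_mon p_nroot x; rewrite -sgr_cp0.
rewrite (@sgp_pinftyP _ x p) ?in_itv /= ?lexx //.
by rewrite /sgp_pinfty (monicP p_mon) sgr1.
Qed.

Lemma polys_sgr_near0 (R : rcfType) (hs : seq {poly R}) :
  exists2 e : R, 0 < e &
    {in hs, forall h, h.[0] != 0 -> Num.sg h.[e] = Num.sg h.[0]}.
Proof.
(* The induction on [hs] needs a whole interval of valid [e], so that two such intervals can be
   intersected. *)
suff [d d0 dP] : exists2 d : R, 0 < d & forall e, 0 < e < d ->
    {in hs, forall h, h.[0] != 0 -> Num.sg h.[e] = Num.sg h.[0]}.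
  by exists (d / 2); [lra | apply: dP; lra].
elim: hs => [|h hs [d d0 dP]]; first by exists 1.
have [h0|h0] := eqVneq h.[0] 0.
  exists d => // e ed g; rewrite inE => /predU1P[-> /eqP//|]; exact: dP.
have [d' d'0 d'P] := @poly_cont R 0 h `|h.[0]| ltac:(by rewrite normr_gt0).
exists (Num.min d d') => [|e]; first by rewrite lt_min d0.
rewrite lt_min => /andP[e0 /andP[ed ed']] g; rewrite inE => /predU1P[->|]; last first.
  by apply: dP; rewrite e0.
move=> _; have := d'P e; rewrite subr0 gtr0_norm // => /(_ ed').
case: (ltrgt0P h.[0]) h0 => // h0 _.
- rewrite ltr_norml => hlt; rewrite !gtr0_sg //; lra.
- rewrite ltr_norml => hlt; rewrite !ltr0_sg //; lra.
Qed.

(** * Composite cycles and the characteristic polynomial *)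

(** Leibniz expansion of the determinant of [X - A], where [T] collects the diagonal places at which
    [X] is chosen. A fixed point of [s] outside [T] contributes its diagonal entry, that is, a
    loop. *)
Lemma char_poly_perm_sum (R : comNzRingType) n (A : 'M[R]_n) :
  char_poly A = \sum_(s : 'S_n) \sum_(T : {set 'I_n} | [forall i in T, s i == i])
    ((-1) ^+ s * \prod_(i in ~: T) - A i (s i)) *: 'X^#|T|.
Proof.
apply: eq_bigr => s _; under eq_bigr do rewrite !mxE.
rewrite bigA_distr mulr_sumr [RHS]big_mkcond /=; apply: eq_bigr => T _.
have -> : (-1) ^+ s = ((-1) ^+ s)%:P :> {poly R} by rewrite rmorphXn rmorphN1.
rewrite -scalerA mul_polyC (bigID [in T]) /=; case: ifP => sT; last first.
  have [i iT siN] := forall_inPn (negbT sT).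
  by rewrite (bigD1 i) //= iT eq_sym (negPf siN) mulr0n !mul0r scaler0.
rewrite (eq_bigr (fun=> 'X)); last first.
  by move=> i iT; rewrite iT (eqP (forall_inP sT i iT)) eqxx.
rewrite prodr_const mulrC (eq_bigr (fun i => (- A i (s i))%:P)); last first.
  by move=> i /negPf->; rewrite polyCN.
by rewrite -rmorph_prod /= mul_polyC; under eq_bigl do rewrite -in_setC.
Qed.

Lemma coef_char_poly (R : comNzRingType) n (A : 'M[R]_n) j :
  (char_poly A)`_j = \sum_(s : 'S_n)
    \sum_(T : {set 'I_n} | [forall i in T, s i == i] && (#|T| == j))
      (-1) ^+ s * \prod_(i in ~: T) - A i (s i).
Proof.
rewrite char_poly_perm_sum coef_sum; apply: eq_bigr => s _; rewrite coef_sum.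
rewrite [RHS]big_mkcondr; apply: eq_bigr => T _.
by rewrite coefZ coefXn eq_sym; case: eqP; rewrite ?mulr1 ?mulr0.
Qed.

(** A positive sum has a positive term; the factor [e] lets one statement serve both signs of the
    coefficient. *)
Lemma coef_char_poly_perm (R : realDomainType) n (A : 'M[R]_n) j e :
  0 < e * (char_poly A)`_j ->
  exists s : 'S_n, exists T : {set 'I_n}, [/\ #|T| = j, {in T, s =1 id} &
    0 < e * ((-1) ^+ s * \prod_(i in ~: T) - A i (s i))].
Proof.
rewrite coef_char_poly mulr_sumr => sum_gt0.
pose good (s : 'S_n) (T : {set 'I_n}) := [&& #|T| == j, [forall i in T, s i == i]
  & 0 < e * ((-1) ^+ s * \prod_(i in ~: T) - A i (s i))].
have [/existsP[s /existsP[T /and3P[/eqP Tj /forall_inP sT gt0]]] | none] :=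
  boolP [exists s, [exists T, good s T]].
  by exists s, T; split=> // i /sT/eqP.
suff: \sum_(s : 'S_n) e * \sum_(T : {set 'I_n} | [forall i in T, s i == i] && (#|T| == j))
    ((-1) ^+ s * \prod_(i in ~: T) - A i (s i)) <= 0 by rewrite leNgt sum_gt0.
apply: sumr_le0 => s _; rewrite mulr_sumr; apply: sumr_le0 => T /andP[sT Tj].
rewrite leNgt; apply: contra none => gt0; apply/existsP; exists s.
by apply/existsP; exists T; rewrite /good Tj sT.
Qed.

(** * Cycle decomposition of a permutation *)

Section PermOrbits.
Variables (n : nat) (s : 'S_n) (T : {set 'I_n}).
Hypothesis sT : {in T, s =1 id}.

Let reps : {set 'I_n} := [set x | froot s x == x].

Lemma fconnect_perm_sym : connect_sym (frel s).
Proof. exact/fconnect_sym/perm_inj. Qed.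

Lemma porbit_fconnect x y : (y \in porbit s x) = fconnect s x y.
Proof.
apply/porbitP/idP => [[i ->]|/iter_findex <-]; first by rewrite permX fconnect_iter.
by exists (findex s x y); rewrite permX.
Qed.

Lemma fconnect_fixed x y : x \in T -> fconnect s x y -> y = x.
Proof.
move=> xT /iter_findex <-; elim: (findex _ _ _) => //= k ->; exact: sT.
Qed.

Lemma froot_orbit x y : x \in reps -> (froot s y == x) = (y \in fingraph.orbit s x).
Proof.
rewrite inE => /eqP rx; rewrite -fconnect_orbit -{1}rx eq_sym.
by rewrite (root_connect fconnect_perm_sym).
Qed.

Lemma mem_froot_fixed x : (froot s x \in T) = (x \in T).
Proof.
have xr : fconnect s x (froot s x) by apply: connect_root.
apply/idP/idP => [rT | xT]; last by rewrite (fconnect_fixed xT xr).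
by rewrite (@fconnect_fixed (froot s x) x) // fconnect_perm_sym.
Qed.

Lemma big_orbits (V : Type) (idx : V) (op : Monoid.com_law idx) (g : 'I_n -> V) :
  \big[op/idx]_(x in reps :\: T) \big[op/idx]_(i <- fingraph.orbit s x) g i =
  \big[op/idx]_(i in ~: T) g i.
Proof.
rewrite [RHS](partition_big (froot s) [in reps :\: T]) /=; last first.
  by move=> i; rewrite !inE mem_froot_fixed => ->; rewrite (root_root fconnect_perm_sym) eqxx.
apply: eq_bigr => x /setDP[xr xT]; rewrite big_uniq ?orbit_uniq //=.
apply: eq_bigl => i; rewrite -froot_orbit // inE; case: eqP => [ix|]; last by rewrite andbF.
by rewrite -mem_froot_fixed ix xT.
Qed.

Lemma card_porbits_fixed : #|porbits s| = (#|T| + #|reps :\: T|)%N.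
Proof.
have -> : porbits s = [set porbit s x | x in reps].
  apply/setP => o; apply/imsetP/imsetP => -[x xr ->]; last by exists x.
  exists (froot s x); first by rewrite inE (root_root fconnect_perm_sym) eqxx.
  by apply/eqP; rewrite eq_porbit_mem porbit_fconnect fconnect_perm_sym connect_root.
rewrite card_in_imset => [|x y]; last first.
  rewrite !inE => /eqP <- /eqP <- /eqP; rewrite eq_porbit_mem porbit_fconnect.
  by rewrite -(root_connect fconnect_perm_sym) !(root_root fconnect_perm_sym) => /eqP ->.
rewrite -(cardsID T reps); congr (#|pred_of_set _| + _)%N.
apply/setP => x; rewrite !inE andb_idl // => xT.
by rewrite (fconnect_fixed xT (connect_root _ x)).
Qed.

(** The cycles are the orbits of [s] outside [T], fixed points there being loops. The signs agree
    because the parity of [s] is that of [n] minus the number of orbits: each point of [T] is an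
    orbit by itself, which leaves the sum of [k - 1] over the cycle lengths [k]. *)
Lemma perm_composite_cycle (P : signPattern n) :
  {in ~: T, forall i, (P i (s i) : int) != 0} ->
  exists C, [/\ composite_cycle P C, composite_length C = (n - #|T|)%N &
    composite_sign P C = (-1) ^+ s * \prod_(i in ~: T) (P i (s i) : int)].
Proof.
move=> Ps; exists [seq fingraph.orbit s x | x <- enum (reps :\: T)].
have orb_cycle x : fcycle s (fingraph.orbit s x) by apply/cycle_orbit/perm_inj.
have orbNT x : x \notin T -> {in fingraph.orbit s x, forall i, i \in ~: T}.
  move=> xT i; rewrite -fconnect_orbit inE => xi; apply: contra xT => iT.
  by rewrite (@fconnect_fixed i x) // fconnect_perm_sym.
have lenE : (\sum_(x in reps :\: T) size (fingraph.orbit s x) = n - #|T|)%N.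
  have <- : #|~: T| = (n - #|T|)%N by rewrite cardsCs setCK card_ord.
  by rewrite -sum1_card -big_orbits; apply: eq_bigr => x _; rewrite sum1_size.
split.
- apply/andP; split.
    apply/allP => c /mapP[x]; rewrite mem_enum => /setDP[xr xT] ->.
    rewrite /simple_cycle orbit_uniq -size_eq0 size_orbit -lt0n fingraph.order_gt0 /=.
    apply: (@sub_in_cycle _ [in ~: T] (frel s)) (orb_cycle x).
      by move=> i j iT _ /eqP <-; apply: Ps.
    by apply/allP; apply: orbNT.
  rewrite pairwise_map.
  have := enum_uniq (reps :\: T); rewrite uniq_pairwise.
  apply: (@sub_in_pairwise _ [in reps :\: T]); last by apply/allP=> x; rewrite mem_enum.
  move=> x y /setDP[xr _] /setDP[yr _] /= xy; rewrite disjoint_has.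
  apply/hasPn => i; rewrite -froot_orbit // => /eqP eqi.
  by rewrite /= -froot_orbit // eqi.
- by rewrite /composite_length big_map big_enum.
- rewrite /composite_sign big_map big_enum /= big_split /=; congr (_ * _).
    rewrite prodrXr.
    have : (\sum_(x in reps :\: T) (size (fingraph.orbit s x)).-1 + #|reps :\: T| = n - #|T|)%N.
      rewrite -lenE -sum1_card -big_split; apply: eq_bigr => x _ /=.
      by rewrite addn1 size_orbit prednK ?fingraph.order_gt0.
    move=> lenE'.
    have -> : (-1) ^+ s = (-1) ^+ (odd #|'I_n| (+) odd #|porbits s|) :> int by [].
    rewrite -[LHS]signr_odd card_porbits_fixed card_ord; congr (_ ^+ nat_of_bool _).
    have : (#|T| <= n)%N by rewrite -[leqRHS]card_ord max_card.
    move/subnK; rewrite -lenE' => /(congr1 odd) <-; rewrite !oddD.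
    by do 3!case: (odd _).
  rewrite -big_orbits; apply: eq_bigr => x _; apply: eq_big_seq => i xi.
  by rewrite -(eqP (next_cycle (orb_cycle x) xi)).
Qed.
End PermOrbits.

(** Some term of the expansion has the sign of the whole coefficient, and its permutation provides
    [C]. The power of -1 comes from the [n - j] entries of [- A] in that term. *)
Lemma coef_char_poly_composite (R : realType) n (P : signPattern n) (A : 'M[R]_n) j :
  qual_class P A -> (char_poly A)`_j != 0 ->
  exists C, [/\ composite_cycle P C, composite_length C = (n - j)%N &
    composite_sign P C = (-1) ^+ (n - j) * sgz (char_poly A)`_j].
Proof.
move=> PA cN0; set c := (char_poly A)`_j in cN0 *.
have [|s [T [Tj sT]]] := @coef_char_poly_perm _ _ A j (Num.sg c).
  by rewrite -/c -normrEsg normr_gt0.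
have sgz_sign k : sgz ((-1) ^+ k : R) = (-1) ^+ k by rewrite sgzX sgzN1.
have sgz_prod : sgz (\prod_(i in ~: T) A i (s i)) = \prod_(i in ~: T) (P i (s i) : int).
  rewrite (big_morph _ (@sgzM R) (sgz1 R)); apply: eq_bigr => i _; exact: PA.
have cardT : #|~: T| = (n - j)%N by rewrite cardsCs setCK card_ord Tj.
rewrite prodrN cardT => gt0.
have sgE : sgz c * ((-1) ^+ s * ((-1) ^+ (n - j) * \prod_(i in ~: T) (P i (s i) : int))) = 1.
  by rewrite -sgz_prod -!sgz_sign -[sgz c]sgz_sgr -!sgzM gtr0_sgz.
have [i iT|C [CP lenC signC]] := perm_composite_cycle sT (P := P).
  apply: contra_eq_neq sgE => Pi0; rewrite (bigD1 i) //= Pi0 mul0r !mulr0.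
  by rewrite eq_sym oner_eq0.
exists C; split; rewrite ?signC ?lenC ?Tj //.
have : sgz c * sgz c = 1 by rewrite -sgzM -expr2 gtr0_sgz ?exprn_even_gt0.
have : (-1) ^+ (n - j) * (-1) ^+ (n - j) = 1 :> int by rewrite -expr2 sqrr_sign.
move: sgE; set a := (-1) ^+ s; set b := (-1) ^+ _; set p := \prod_(i in _) _.
move: (sgz c) => d E bb dd.
rewrite -[RHS]mulr1 -E mulrA -(mulrA b) (mulrA d) dd mul1r (mulrC a b).
by rewrite -[b * a * p]mulrA [b * (b * _)]mulrA bb mul1r.
Qed.

(** * Characteristic polynomials of weighted cycles *)

Definition cycle_mx (R : nmodType) n (B : 'M[R]_n) (c : seq 'I_n) : 'M[R]_n :=
  \matrix_(i, j) if (i \in c) && (j == next c i) then B i j else 0.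

Section CyclePerm.
Variables (n : nat) (c : seq 'I_n).
Hypothesis (Uc : uniq c).

Definition next_perm : 'S_n := perm (can_inj (prev_next Uc)).

Lemma next_perm_id : {in ~: [set i in c], next_perm =1 id}.
Proof.
move=> i; rewrite !inE permE => iNc; case: c iNc => //= x p.
rewrite inE negb_or => /andP[ix ip].
have: forall y, i != y -> next_at i x y p = i.
  elim: p ip => [|z p IHp] /= ip y; first by move/negPf->.
  by move/negPf->; move: ip; rewrite inE negb_or => /andP[iz ip]; apply: IHp.
by apply.
Qed.

Lemma fconnect_next_perm x y : x \in c -> fconnect next_perm x y = (y \in c).
Proof.
move=> xc; apply: (@fconnect_cycle _ _ c) => //.
by rewrite (eq_cycle (e' := frel (next c))) ?cycle_next // => i j; rewrite /= permE.
Qed.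

(** With [k] the length of [c], the orbits are [c] itself and [n - k] singletons, so the parity is
    that of [n - (n - k + 1) = k - 1]. *)
Lemma odd_next_perm : c != [::] -> odd_perm next_perm = odd (size c).-1.
Proof.
move=> c0; have [x xc] : exists x, x \in c.
  by case: (c) c0 => // x p _; exists x; rewrite mem_head.
rewrite /odd_perm (card_porbits_fixed next_perm_id).
rewrite (_ : _ :\: _ = [set froot next_perm x]) ?cards1.
  rewrite cardsCs setCK cardsE (card_uniqP Uc) addn1 /=.
  have : (size c <= #|'I_n|)%N by rewrite -(card_uniqP Uc) max_card.
  have : (0 < size c)%N by case: (c) c0.
  case: (size c) => // k _ lt_k; rewrite oddB //=.
  by case: (odd _); case: (odd _).
apply/setP=> y; rewrite !inE negbK; apply/andP/eqP => [[yc /eqP<-]|->].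
  by apply/eqP; rewrite (root_connect (fconnect_perm_sym _)) fconnect_perm_sym fconnect_next_perm.
by rewrite -(fconnect_next_perm _ xc) connect_root (root_root (fconnect_perm_sym _)).
Qed.

(** The identity with [T] full gives [X^n]. The rotation along [c], with [T] the complement of [c],
    gives the other term: its signature [(-1)^(k-1)] and the [k] negated entries combine into a
    minus sign. *)
Lemma char_poly_cycle (R : comNzRingType) (B : 'M[R]_n) : c != [::] ->
  char_poly (cycle_mx B c) =
  'X^(n - size c) * ('X^(size c) - (\prod_(i <- c) B i (next c i))%:P).
Proof.
move=> c0; have size_c : #|[set i in c]| = size c by rewrite cardsE (card_uniqP Uc).
have le_c : (size c <= n)%N by rewrite -size_c -[leqRHS]card_ord max_card.
rewrite char_poly_perm_sum pair_big_dep /= (bigD1 (1%g, setT)) /=; last first.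
  by apply/forall_inP => i _; rewrite perm1.
rewrite (bigD1 (next_perm, ~: [set i in c])) /=; last first.
  apply/andP; split; first by apply/forall_inP=> i /next_perm_id ->.
  rewrite -pair_eqE negb_and orbC -(inj_eq (@setC_inj _)) setCK setCT -cards_eq0.
  by rewrite size_c size_eq0 c0.
rewrite [X in _ + (_ + X)]big1 ?addr0 => [|[s T] /= /andP[/andP[/forall_inP sT nT] nC]].
  rewrite setCT big_set0 odd_perm1 mulr1 scale1r cardsT card_ord mulrBr -exprD subnK //.
  congr (_ + _); rewrite setCK cardsCs setCK card_ord size_c [_ * _%:P]mulrC mul_polyC.
  rewrite -scaleNr; congr (_ *: _); rewrite prodrN size_c odd_next_perm //.
  rewrite [in LHS](eq_bigr (fun i => B i (next c i))); last first.
    by move=> i; rewrite inE => ic; rewrite !mxE permE ic eqxx.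
  rewrite big_uniq //= mulrA [in LHS](eq_bigl [in c]); last by move=> i; rewrite inE.
  case: (size c) (size_eq0 c) c0 => [<- //|k _ _] /=.
  by rewrite signr_odd exprS mulrCA -expr2 sqrr_sign mulr1 mulN1r.
(* A permutation with a nonzero term that moves some vertex along [c] must move
   all of [c], so only the identity and [next_perm] contribute. *)
have [/existsP[i /andP[iT /eqP iN]] | none] :=
  boolP [exists i, (i \notin T) && (cycle_mx B c i (s i) == 0)].
  by rewrite (bigD1 i) ?inE //= iN oppr0 mul0r mulr0 scale0r.
have outT i : i \notin T -> i \in c /\ s i = next c i.
  move=> iT; move: none; rewrite negb_exists => /forallP/(_ i); rewrite iT mxE.
  by case: ifP => [/andP[-> /eqP]|]; rewrite ?eqxx.
have [/subsetP cT | /subsetPn[x xc xT]] := boolP ([set i in c] \subset T).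
  have sub i : i \in T.
    by apply: contraT => iT; have [ic _] := outT i iT; rewrite -(negPf iT) cT ?inE.
  case/eqP: nT; congr (_, _); last by apply/setP=> i; rewrite sub inE.
  by apply/permP => i; rewrite perm1; apply/eqP/sT.
(* Following [c] from [x] never enters [T]: if [next c z = s z] were in [T], it would be fixed by
   [s], and injectivity would give [s z = z], putting [z] in [T]. *)
have cNT y : y \in c -> y \notin T.
  rewrite inE in xc; rewrite -(fconnect_next_perm y xc) => /iter_findex <-.
  elim: (findex _ _ _) => //= k; set z := iter k _ x => zT.
  apply/negP; rewrite permE => nzT; have [_ sz] := outT z zT.
  have /eqP := sT _ nzT; rewrite -sz => /perm_inj szz.
  by move: zT; rewrite -szz sz nzT.
have TE : T = ~: [set i in c].
  apply/setP=> i; rewrite !inE.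
  by apply/idP/idP=> [|/(contraR _)]; [apply: contraL => /cNT|apply=> /outT[]].
case/eqP: nC; rewrite -TE; congr (_, _); apply/permP=> i.
have [iT | /outT[_ ->]] := boolP (i \in T); last by rewrite permE.
by rewrite next_perm_id -?TE //; apply/eqP/sT.
Qed.
End CyclePerm.

(* Because [(X - A)(X - B) = X (X - (A + B))]. *)
Lemma char_polyD (R : comNzRingType) n (A B : 'M[R]_n) :
  A *m B = 0 -> 'X^n * char_poly (A + B) = char_poly A * char_poly B.
Proof.
move=> AB0; rewrite /char_poly -det_mulmx -detZ; congr (\det _).
rewrite /char_poly_mx mulmxBl !mulmxBr -map_mxM AB0 map_mx0 subr0.
by rewrite !mul_scalar_mx !mul_mx_scalar scalerBr map_mxD scalerDr opprD addrA addrAC.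
Qed.

Lemma char_poly0 (R : comNzRingType) n : char_poly (0 : 'M[R]_n) = 'X^n.
Proof. by rewrite /char_poly /char_poly_mx map_mx0 subr0 det_scalar. Qed.

Lemma simple_cycle_uniq n (P : signPattern n) c : simple_cycle P c -> uniq c.
Proof. by case/and3P. Qed.

Lemma composite_cycle_cons n (P : signPattern n) c C :
  composite_cycle P (c :: C) =
  [&& simple_cycle P c, all [pred d | [disjoint c & d]] C & composite_cycle P C].
Proof. by rewrite /composite_cycle /= -!andbA; do !bool_congr. Qed.

Lemma composite_cycle_uniq n (P : signPattern n) C :
  composite_cycle P C -> uniq (flatten C).
Proof.
elim: C => //= c C IHC; rewrite composite_cycle_cons => /and3P[cP dis /IHC UC].
rewrite cat_uniq (simple_cycle_uniq cP) UC andbT; apply/hasPn => i /flattenP[d dC id].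
 
by move/allP/(_ d dC): dis => /=; rewrite disjoint_sym disjoint_has => /hasPn/(_ i id).
Qed.

Lemma composite_length_le n (P : signPattern n) C :
  composite_cycle P C -> (composite_length C <= n)%N.
Proof.
move=> CP; have -> : composite_length C = size (flatten C).
  by rewrite size_flatten sumnE big_map.
by rewrite -(card_uniqP (composite_cycle_uniq CP)) -[leqRHS]card_ord max_card.
Qed.

(** The matrices of two disjoint cycles have product 0, so [char_polyD] splits off one cycle at a
    time; its extra factor ['X^n] is cancelled. *)
Lemma char_poly_composite (R : idomainType) n (P : signPattern n) (B : 'M[R]_n) C :
  composite_cycle P C ->
  char_poly (\sum_(c <- C) cycle_mx B c) = 'X^(n - composite_length C) *
    \prod_(c <- C) ('X^(size c) - (\prod_(i <- c) B i (next c i))%:P).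
Proof.
elim: C => [|c C IHC] CP.
  by rewrite /composite_length !big_nil subn0 mulr1 char_poly0.
have := composite_length_le CP; rewrite /composite_length !big_cons.
move: CP; rewrite composite_cycle_cons => /and3P[cP /allP dis CP] le_n.
apply: (@mulfI _ 'X^n); first exact: monic_neq0 (monicXn _ _).
rewrite char_polyD; last first.
  rewrite mulmx_sumr big1_seq // => d /andP[_ dC]; apply/matrixP=> i j; rewrite !mxE.
  apply: big1 => k _; rewrite !mxE.
  case: ifP => [/andP[ic /eqP kc]|]; rewrite ?mul0r //.
  case: ifP => [/andP[kd _]|]; rewrite ?mulr0 //.
  have := dis d dC; rewrite /= disjoint_has => /hasPn/(_ k).
  by rewrite kc mem_next ic -kc kd => /(_ isT).
have /and3P[c0 Uc _] := cP.
rewrite IHC // char_poly_cycle // mulrACA [RHS]mulrA -!exprD; congr ('X^_ * _).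
rewrite /composite_length; lia.
Qed.

(** * Perturbation inside the qualitative class *)

(* [weighted P U] is in [Q(P)] when [U > 0]; letting entries of [U] vanish gives
   the limits of such matrices. *)
Definition weighted (R : pzRingType) n (P : signPattern n) (U : 'M[R]_n) : 'M[R]_n :=
  \matrix_(i, j) (U i j * (P i j : int)%:~R).

Lemma weighted_qual_class (R : realType) n (P : signPattern n) (U : 'M[R]_n) :
  (forall i j, 0 < U i j) -> qual_class P (weighted P U).
Proof.
move=> U_gt0 i j; rewrite mxE sgzM gtr0_sgz // mul1r.
by case: (P i j); rewrite /= ?sgz1 ?sgzN1 ?sgz0.
Qed.

Lemma weighted_sum_cycle_mx (R : pzRingType) n (P : signPattern n) (U : 'M[R]_n) C :
  weighted P (\sum_(c <- C) cycle_mx U c) = \sum_(c <- C) cycle_mx (weighted P U) c.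
Proof.
apply/matrixP=> i j; rewrite mxE !summxE mulr_suml; apply: eq_bigr => c _.
by rewrite !mxE; case: ifP; rewrite ?mul0r.
Qed.

(** Source of all continuity arguments: along a line of matrices, the coefficients and the values at
    fixed points are polynomials in [t]. The inner variable of [G] is [t]. *)
Lemma char_poly_line (R : comNzRingType) n (A B : 'M[R]_n) :
  exists G : {poly {poly R}},
    forall t, char_poly (A + t *: B) = map_poly (horner_eval t) G.
Proof.
exists (char_poly (map_mx polyC A + 'X *: map_mx polyC B)) => t.
rewrite map_char_poly; congr char_poly; apply/matrixP=> i j.
by rewrite !mxE /= /horner_eval !hornerE.
Qed.

Lemma weightedD (R : pzRingType) n (P : signPattern n) (U V : 'M[R]_n) :
  weighted P (U + V) = weighted P U + weighted P V.
Proof. by apply/matrixP=> i j; rewrite !mxE mulrDl. Qed.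

Lemma weightedZ (R : pzRingType) n (P : signPattern n) t (U : 'M[R]_n) :
  weighted P (t *: U) = t *: weighted P U.
Proof. by apply/matrixP=> i j; rewrite !mxE mulrA. Qed.

(** Adding a small positive constant to all weights makes them positive, and a nonzero value or
    coefficient keeps its sign. Finitely many tests allow a common constant. *)
Lemma qual_class_near (R : realType) n (P : signPattern n) (U : 'M[R]_n)
    (xs : seq R) (js : seq nat) :
  (forall i j, 0 <= U i j) -> let p := char_poly (weighted P U) in
  exists V : 'M[R]_n, [/\ forall i j, 0 < V i j,
    {in xs, forall x, p.[x] != 0 ->
       Num.sg (char_poly (weighted P V)).[x] = Num.sg p.[x]} &
    {in js, forall j, p`_j != 0 ->
       Num.sg (char_poly (weighted P V))`_j = Num.sg p`_j}].
Proof.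
move=> U_ge0 p; pose I : 'M[R]_n := const_mx 1.
have [G GE] := char_poly_line (weighted P U) (weighted P I).
have p_x x t : (char_poly (weighted P U + t *: weighted P I)).[x] = (G.[x%:P]).[t].
  by rewrite GE -{1}[x](hornerC x t) -/(horner_eval t x%:P) horner_map.
have p_j j t : (char_poly (weighted P U + t *: weighted P I))`_j = (G`_j).[t].
  by rewrite GE coef_map.
have pE : p = char_poly (weighted P U + 0 *: weighted P I) by rewrite scale0r addr0.
have [e e0 eP] := polys_sgr_near0 ([seq G.[x%:P] | x <- xs] ++ [seq G`_j | j <- js]).
exists (U + e *: I); rewrite weightedD weightedZ pE; split.
- by move=> i j; rewrite !mxE mulr1 ltr_wpDl.
- move=> x xs_x; rewrite !p_x; apply: eP; rewrite mem_cat; apply/orP; left.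
  by apply/mapP; exists x.
- move=> j js_j; rewrite !p_j; apply: eP; rewrite mem_cat; apply/orP; right.
  by apply/mapP; exists j.
Qed.

(** * Consequences of having exactly two real eigenvalues *)

Lemma ltr_Xn_odd (R : realFieldType) k (x y : R) : odd k -> x < y -> x ^+ k < y ^+ k.
Proof.
move=> k_odd xy; have k0 : k != 0%N by case: k k_odd.
have [y0|y0] := ltP 0 y.
  have [x0|x0] := leP 0 x; first by rewrite ltr_pXn2r ?lt0n ?nnegrE ?(ltW y0).
  by apply: (@lt_le_trans _ _ 0); rewrite ?exprn_odd_lt0 ?exprn_ge0 ?(ltW y0).
have : (- y) ^+ k < (- x) ^+ k.
  by rewrite ltr_pXn2r ?lt0n ?nnegrE ?oppr_ge0 ?ltrN2 //; apply: ltW; apply: lt_le_trans y0.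
by rewrite (exprNn x) (exprNn y) -signr_odd k_odd !mulN1r ltrN2.
Qed.

(** For odd [k] the power map is increasing, so [X^k - r^k] changes sign exactly at [r]; the next
    lemma is the case of an interval that misses [r]. *)
Lemma subXn_odd_cross (R : realFieldType) k (x y r : R) : odd k -> x < r < y ->
  (x ^+ k - r ^+ k) * (y ^+ k - r ^+ k) < 0.
Proof.
by move=> ko /andP[xr ry]; rewrite nmulr_rlt0 ?subr_gt0 ?subr_lt0 ltr_Xn_odd.
Qed.

Lemma subXn_odd_same (R : realFieldType) k (x y r : R) : odd k -> x < y ->
  (y < r) || (r < x) -> 0 < (x ^+ k - r ^+ k) * (y ^+ k - r ^+ k).
Proof.
move=> ko xy /orP[yr|rx].
  by rewrite nmulr_rgt0 ?subr_lt0 ltr_Xn_odd // (lt_trans xy).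
by rewrite pmulr_rgt0 ?subr_gt0 ltr_Xn_odd // (lt_trans rx).
Qed.

(** Used on intervals of radius 1/2 that avoid 0: there the factor ['X^(n - composite_length C)]
    does not disturb a sign change. *)
Lemma mul_sub_add_half_gt0 (R : realFieldType) (x : R) :
  (x < - 2^-1) || (2^-1 < x) -> 0 < (x - 2^-1) * (x + 2^-1).
Proof. by case/orP=> ?; [rewrite nmulr_rgt0 | rewrite pmulr_rgt0]; lra. Qed.

Lemma cycle_sign_pm1 n (P : signPattern n) c :
  simple_cycle P c -> cycle_sign P c = 1 \/ cycle_sign P c = -1.
Proof.
case/and3P=> _ _ cP; suff: `|cycle_sign P c| = 1 by lia.
rewrite normrM normrX normrN1 expr1n mul1r normr_prod big1_seq // => i /andP[_ ic].
by have := next_cycle cP ic; rewrite /Defs.arc; case: (P i _).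
Qed.

Lemma prod_cycle_sign n (P : signPattern n) (c : seq 'I_n) :
  \prod_(i <- c) (P i (next c i) : int) = (-1) ^+ (size c).-1 * cycle_sign P c.
Proof. by rewrite mulrA -expr2 sqrr_sign mul1r. Qed.

Lemma char_poly_emphasized (R : realType) n (P : signPattern n) (u : 'I_n -> R) C :
  composite_cycle P C ->
  char_poly (weighted P (\sum_(c <- C) cycle_mx (\matrix_(i, _) u i) c)) =
  'X^(n - composite_length C) * \prod_(c <- C) ('X^(size c) -
     (\prod_(i <- c) u i * (- 1) ^+ (size c).-1 * (cycle_sign P c)%:~R)%:P).
Proof.
move=> CP; rewrite weighted_sum_cycle_mx (char_poly_composite _ CP); congr (_ * _).
apply: eq_bigr => c _; congr (_ - _%:P).
under eq_bigr do rewrite !mxE.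
rewrite big_split /= -mulrA; congr (_ * _).
by rewrite -rmorph_prod /= prod_cycle_sign rmorphM rmorphXn /= rmorphN1.
Qed.

(** A sign change of the limit polynomial persists for a nearby matrix of the class, where the
    intermediate value theorem turns it into an eigenvalue. *)
Lemma qual_class_roots_near (R : realType) n (P : signPattern n) (U : 'M[R]_n)
    (its : seq (R * R)) :
  (forall i j, 0 <= U i j) -> let p := char_poly (weighted P U) in
  {in its, forall ab, ab.1 <= ab.2 /\ p.[ab.1] * p.[ab.2] < 0} ->
  exists2 A : 'M[R]_n, qual_class P A &
    {in its, forall ab, exists2 x, ab.1 < x < ab.2 & root (char_poly A) x}.
Proof.
move=> U0 p its_p.
have [V [V0 Vp _]] :=
  @qual_class_near R n P U ([seq ab.1 | ab <- its] ++ [seq ab.2 | ab <- its]) [::] U0.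
exists (weighted P V) => [|[a b] abi]; first exact: weighted_qual_class.
have /= [leab ltp] := its_p _ abi.
move: (char_poly (weighted P V)) Vp => q Vp.
have sg_a : Num.sg q.[a] = Num.sg p.[a].
  apply: Vp; last by apply: contraTneq ltp => ->; rewrite mul0r ltxx.
  by rewrite mem_cat (map_f (fun ab => ab.1) abi).
have sg_b : Num.sg q.[b] = Num.sg p.[b].
  apply: Vp; last by apply: contraTneq ltp => ->; rewrite mulr0 ltxx.
  by rewrite mem_cat (map_f (fun ab => ab.2) abi) orbT.
have [|x] := poly_ivtoo (p := q) leab; last by exists x.
by rewrite -sgr_cp0 sgrM sg_a sg_b -sgrM sgr_cp0.
Qed.

Lemma nonneg_sum_cycle_mx (R : realType) n (u : 'I_n -> R) C :
  (forall i, 0 <= u i) ->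
  forall i j, 0 <= (\sum_(c <- C) cycle_mx (\matrix_(i, _) u i) c) i j.
Proof.
move=> u0 i j; rewrite summxE sumr_ge0 // => c _; rewrite !mxE.
by case: ifP; rewrite ?mxE.
Qed.

Lemma composite_cycle1 n (P : signPattern n) c :
  simple_cycle P c -> composite_cycle P [:: c].
Proof. by rewrite /composite_cycle /= => ->. Qed.

Section TwoRealEigenvalues.
Variables (R : realType) (n : nat) (P : signPattern n).
Hypothesis (Psing : sign_singular R P) (PDelta : requires_two_real_eigenvalues R P).

Lemma char_poly_coef0 (A : 'M[R]_n) : qual_class P A -> (char_poly A)`_0 = 0.
Proof.
by move/Psing; rewrite unitmxE unitfE negbK char_poly_det => /eqP->; rewrite mulr0.
Qed.

Lemma root_char_poly_0 (A : 'M[R]_n) : qual_class P A -> root (char_poly A) 0.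
Proof. by move=> /char_poly_coef0 p0; rewrite rootE horner_coef0 p0. Qed.

(** The form in which the hypothesis on eigenvalues is used; [a], [b] and [c] may coincide, which
    covers multiple roots. *)
Lemma prod3_ndvd (A : 'M[R]_n) a b c : qual_class P A ->
  ~ ('X - a%:P) * ('X - b%:P) * ('X - c%:P) %| char_poly A.
Proof.
move=> PA dvd; have := @size_le_nb_real_eigenvalues R n A [:: a; b; c].
by rewrite !big_cons big_nil mulr1 mulrA PDelta // => /(_ dvd).
Qed.

Lemma two_nonzero_roots_eq (A : 'M[R]_n) x y : qual_class P A ->
  root (char_poly A) x -> root (char_poly A) y -> x != 0 -> y != 0 -> x = y.
Proof.
move=> PA px py x0 y0; apply/eqP/negPn/negP => xy.
apply: (prod3_ndvd (a := 0) (b := x) (c := y) PA).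
have := @uniq_roots_dvdp R (char_poly A) [:: 0; x; y].
rewrite !big_cons big_nil mulr1 mulrA; apply; first by rewrite /= root_char_poly_0 // px py.
by rewrite uniq_rootsE /= !inE negb_or eq_sym x0 eq_sym y0 xy.
Qed.

Lemma coef1_root_eq0 (A : 'M[R]_n) x : qual_class P A ->
  (char_poly A)`_1 = 0 -> root (char_poly A) x -> x = 0.
Proof.
move=> PA p1 px; apply/eqP/negPn/negP => x0.
have /dvdpP[q qE] : 'X^2 %| char_poly A.
  by apply: polyX_dvd => -[|[|//]] _ //; apply: char_poly_coef0.
apply: (prod3_ndvd (a := 0) (b := 0) (c := x) PA); rewrite subr0 -expr2 qE mulrC.
rewrite dvdp_mul2r ?monic_neq0 ?monicXn // dvdp_XsubCl.
move: px; rewrite qE rootM => /orP[//|].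
by rewrite rootE hornerXn expf_eq0 (negPf x0).
Qed.

Lemma coef1_coef2_neq0 (A : 'M[R]_n) : qual_class P A ->
  (char_poly A)`_1 = 0 -> (char_poly A)`_2 != 0.
Proof.
move=> PA p1; apply/eqP => p2; apply: (prod3_ndvd (a := 0) (b := 0) (c := 0) PA).
rewrite subr0 -expr2 -exprSr; apply: polyX_dvd => -[|[|[|//]]] _ //.
exact: char_poly_coef0.
Qed.

(** The characteristic polynomial is [X (X - x) q], where [q] is monic without real roots and hence
    positive at 0; the coefficient of [X] is [- x q(0)]. *)
Lemma sgz_coef1_root (A : 'M[R]_n) x : qual_class P A ->
  root (char_poly A) x -> x != 0 -> sgz (char_poly A)`_1 = - sgz x.
Proof.
move=> PA px x0.
have /dvdpP[q qE] : 'X * ('X - x%:P) %| char_poly A.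
  have := @uniq_roots_dvdp R (char_poly A) [:: 0; x].
  rewrite !big_cons big_nil mulr1 subr0; apply; first by rewrite /= root_char_poly_0 ?px.
  by rewrite uniq_rootsE /= inE eq_sym x0.
have q_monic : q \is monic.
  by have := char_poly_monic A; rewrite qE monicMr // monicMl ?monicX ?monicXsubC.
have q0 : 0 < q.[0].
  apply: monic_no_root_gt0 => // y; apply/negP => qy.
  apply: (prod3_ndvd (a := 0) (b := x) (c := y) PA).
  by rewrite qE subr0 mulrC dvdp_mul2r ?dvdp_XsubCl // mulf_neq0 ?polyX_eq0 ?polyXsubC_eq0.
rewrite qE mulrCA coefXM /= -horner_coef0 !hornerE sgzM (gtr0_sgz q0) mul1r.
by rewrite ?sub0r sgzN.
Qed.
End TwoRealEigenvalues.

(** * Eigenvalues forced by cycles and zero submatrices *)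

Lemma odd_cycle_root (R : realType) n (P : signPattern n) c :
  simple_cycle P c -> odd (size c) ->
  exists2 A : 'M[R]_n, qual_class P A &
    exists2 x : R, root (char_poly A) x & sgz x = cycle_sign P c.
Proof.
move=> cP c_odd; have CP := composite_cycle1 cP.
have a_pm := cycle_sign_pm1 cP; set a : R := (cycle_sign P c)%:~R.
have a_pmR : a = 1 \/ a = -1 by rewrite /a; case: a_pm => ->; [left | right].
(* With unit weights the limit has the factor [X^k - a], [k] odd, with root [a] since [a^k = a];
   radius 1/2 keeps 0 out of the interval. *)
have [|A PA Aroot] := @qual_class_roots_near R n P _ [:: (a - 2^-1, a + 2^-1)]
    (nonneg_sum_cycle_mx [:: c] (fun=> ler01)).
  move=> _ /[!inE] /eqP -> /=; split; first by lra.
  rewrite char_poly_emphasized // big_seq1 /composite_length big_seq1.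
  rewrite !(hornerM, hornerD, hornerN, hornerXn, hornerC) big1_eq.
  rewrite -signr_odd; have -> : odd (size c).-1 = false by case: (size c) c_odd => //= k /negPf.
  rewrite expr0 !mul1r -/a mulrACA -exprMn pmulr_rlt0.
    have := @subXn_odd_cross R (size c) (a - 2^-1) (a + 2^-1) a c_odd.
    have -> : a ^+ size c = a by case: a_pmR => ->; rewrite ?expr1n // -signr_odd c_odd.
    by apply; lra.
  by apply/exprn_gt0/mul_sub_add_half_gt0; case: a_pmR => ->; lra.
exists A => //; have [|x /= ax px] := Aroot (a - 2^-1, a + 2^-1); first exact: mem_head.
exists x => //; move: ax; rewrite /a.
case: a_pm => ->; rewrite ?rmorphN1 => ax; first by rewrite gtr0_sgz //; lra.
by rewrite ltr0_sgz //; lra.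
Qed.

Lemma odd_cycle_coef1 (R : realType) n (P : signPattern n)
    (Psing : sign_singular R P) (PDelta : requires_two_real_eigenvalues R P) c :
  simple_cycle P c -> odd (size c) ->
  exists2 A : 'M[R]_n, qual_class P A & sgz (char_poly A)`_1 = - cycle_sign P c.
Proof.
move=> cP c_odd; have [A PA [x px xc]] := odd_cycle_root R cP c_odd.
exists A => //; rewrite (sgz_coef1_root Psing PDelta PA px) ?xc //.
by rewrite -sgz_eq0 xc; case: (cycle_sign_pm1 cP) => ->.
Qed.

Lemma disjoint_odd_cycles (R : realType) n (P : signPattern n)
    (Psing : sign_singular R P) (PDelta : requires_two_real_eigenvalues R P) c d :
  simple_cycle P c -> odd (size c) -> simple_cycle P d -> odd (size d) ->
  ~~ [disjoint c & d].
Proof.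
move=> cP c_odd dP d_odd; apply/negP => cd.
have CP : composite_cycle P [:: c; d] by rewrite /composite_cycle /= cP dP cd.
(* Weight 2 on [d] moves its root to [2 * b], away from [a] even when the two cycles have the same
   sign. *)
pose u i : R := if i \in d then 2 else 1.
have u_ge0 i : 0 <= u i by rewrite /u; case: ifP.
have oddP (e : seq 'I_n) : odd (size e) -> odd (size e).-1 = false.
  by case: (size e) => //= k /negPf.
pose a : R := (cycle_sign P c)%:~R; pose b : R := (cycle_sign P d)%:~R.
have a_pm : a = 1 \/ a = -1 by rewrite /a; case: (cycle_sign_pm1 cP) => ->; [left | right].
have b_pm : b = 1 \/ b = -1 by rewrite /b; case: (cycle_sign_pm1 dP) => ->; [left | right].
have aE : a ^+ size c = a by case: a_pm => ->; rewrite ?expr1n // -signr_odd c_odd.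
have bE : b ^+ size d = b by case: b_pm => ->; rewrite ?expr1n // -signr_odd d_odd.
have uc : \prod_(i <- c) u i = 1.
  apply: big1_seq => i /andP[_ ic]; rewrite /u; case: ifP => // id.
  by move: cd; rewrite disjoint_has => /hasPn/(_ i ic); rewrite id.
have ud : \prod_(i <- d) u i = 2 ^+ size d.
  rewrite (eq_big_seq (fun=> 2)); last by move=> i id; rewrite /u id.
  by rewrite big_const_seq count_predT; elim: (size d) => //= k ->; rewrite exprS.
set U := \sum_(e <- [:: c; d]) cycle_mx (\matrix_(i, _) u i) e.
have pE x : (char_poly (weighted P U)).[x] = x ^+ (n - composite_length [:: c; d]) *
    ((x ^+ size c - a ^+ size c) * (x ^+ size d - (2 * b) ^+ size d)).
  rewrite char_poly_emphasized // !big_cons big_nil mulr1 uc ud.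
  rewrite -(signr_odd _ (size c).-1) -(signr_odd _ (size d).-1) !oddP // !expr0 mulr1 mul1r.
  rewrite mulr1 exprMn bE aE -/a -/b.
  by rewrite !(hornerM, hornerD, hornerN, hornerXn, hornerC).
(* These open intervals are disjoint and avoid 0, and each contains the root of just one factor, so
   the other factor keeps its sign there. *)
have [|A PA Aroot] := @qual_class_roots_near R n P U
    [:: (a - 2^-1, a + 2^-1); (2 * b - 2^-1, 2 * b + 2^-1)] (nonneg_sum_cycle_mx _ u_ge0).
  move=> _ /[!inE] /orP[]/eqP -> /=; (split; first by lra); rewrite !pE mulrACA -exprMn.
    rewrite pmulr_rlt0; last first.
      by apply/exprn_gt0/mul_sub_add_half_gt0; case: a_pm => ->; lra.
    rewrite mulrACA nmulr_rlt0.
      by apply: subXn_odd_same => //; [lra|]; case: a_pm; case: b_pm => -> ->; lra.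
    by apply: subXn_odd_cross => //; lra.
  rewrite pmulr_rlt0; last first.
    by apply/exprn_gt0/mul_sub_add_half_gt0; case: b_pm => ->; lra.
  rewrite mulrACA pmulr_rlt0; first by apply: subXn_odd_cross => //; lra.
  by apply: subXn_odd_same => //; [lra|]; case: a_pm; case: b_pm => -> ->; lra.
have [|x /= ax px] := Aroot (a - 2^-1, a + 2^-1); first exact: mem_head.
have [|y /= ay py] := Aroot (2 * b - 2^-1, 2 * b + 2^-1); first by rewrite !inE eqxx orbT.
have x0 : x != 0 by apply/eqP; case: a_pm ax => ->; lra.
have y0 : y != 0 by apply/eqP; case: b_pm ay => ->; lra.
have := two_nonzero_roots_eq Psing PDelta PA px py x0 y0.
by move: ax ay; case: a_pm; case: b_pm => -> ->; lra.
Qed.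

Lemma even_cycle_ge0 (R : realType) n (P : signPattern n)
    (Psing : sign_singular R P) (PDelta : requires_two_real_eigenvalues R P) c :
  simple_cycle P c -> ~~ odd (size c) -> 0 <= cycle_sign P c.
Proof.
move=> cP c_even; case: (cycle_sign_pm1 cP) => cs; first by rewrite cs.
have c0 : size c != 0%N by case/and3P: cP => /negPf c0 _ _; rewrite size_eq0 c0.
have CP := composite_cycle1 cP.
set U := \sum_(e <- [:: c]) cycle_mx (\matrix_(i, _) (1 : R)) e.
(* For even length and negative sign, the product of the entries along [c] is 1, so both 1 and -1
   are roots of the limit. *)
have pE x : (char_poly (weighted P U)).[x] = x ^+ (n - composite_length [:: c]) * (x ^+ size c - 1).
  rewrite char_poly_emphasized // big_seq1 cs rmorphN1 big1_eq mul1r.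
  rewrite -signr_odd; have -> : odd (size c).-1 by case: (size c) c0 c_even => //= k _ /negPn.
  by rewrite expr1 mulrNN mulr1 !(hornerM, hornerD, hornerN, hornerXn, hornerC).
have lt1 : 2^-1 ^+ size c < 1 :> R by rewrite exprn_ilt1 //; lra.
have gt1 : 1 < 2 ^+ size c :> R by rewrite exprn_egt1 //; lra.
have evenN x : (- x) ^+ size c = x ^+ size c :> R by rewrite exprNn -signr_odd (negPf c_even) mul1r.
have [|A PA Aroot] := @qual_class_roots_near R n P U
    [:: (2^-1, 2); (- 2, - 2^-1)] (nonneg_sum_cycle_mx _ (fun=> ler01)).
  move=> _ /[!inE] /orP[]/eqP -> /=; (split; first by lra); rewrite !pE mulrACA -exprMn ?evenN.
    by rewrite mulVf ?pnatr_eq0 // expr1n mul1r nmulr_rlt0 ?subr_gt0 ?subr_lt0.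
  by rewrite mulrNN mulfV ?pnatr_eq0 // expr1n mul1r pmulr_rlt0 ?subr_gt0 ?subr_lt0.
have [|x /= ax px] := Aroot (2^-1, 2); first exact: mem_head.
have [|y /= ay py] := Aroot (- 2, - 2^-1); first by rewrite !inE eqxx orbT.
have x0 : x != 0 by apply/eqP; lra.
have y0 : y != 0 by apply/eqP; lra.
exfalso; have := two_nonzero_roots_eq Psing PDelta PA px py x0 y0; lra.
Qed.

(** A nonzero term of the coefficient of [X^j] maps the rows of [a] outside [T] injectively into the
    columns outside [b], so [|a| - j <= n - |b|]. If [|a| + |b| > n + 2], this excludes [j < 3], and
    0 is a triple root. *)
Lemma zero_submatrix_le (R : realType) n (P : signPattern n)
    (Psing : sign_singular R P) (PDelta : requires_two_real_eigenvalues R P)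
    (a b : {set 'I_n}) :
  zero_submatrix P a b -> (#|a| + #|b| <= n + 2)%N.
Proof.
move=> ab0; rewrite leqNgt; apply/negP => lt_ab.
pose A : 'M[R]_n := weighted P (const_mx 1).
have PA : qual_class P A by apply: weighted_qual_class => i j; rewrite mxE.
apply: (prod3_ndvd (a := 0) (b := 0) (c := 0) PDelta PA); rewrite subr0 -expr2 -exprSr.
apply: polyX_dvd => j j3; apply/eqP/negPn/negP => pj.
have [|s [T [Tj _ prod_gt0]]] := @coef_char_poly_perm _ _ A j (char_poly A)`_j.
  by rewrite -expr2 exprn_even_gt0 // pj.
have sub_b : s @: (a :\: T) \subset ~: b.
  apply/subsetP => _ /imsetP[i /setDP[ia iT] ->]; rewrite inE; apply: contraTN prod_gt0 => sib.
  by rewrite (bigD1 i) ?inE //= mxE (ab0 i (s i)) //= mulr0 oppr0 mul0r !mulr0 ltxx.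
have := subset_leq_card sub_b; rewrite card_imset; last exact: perm_inj.
rewrite cardsD [X in (_ <= X)%N]cardsCs setCK card_ord.
have := subset_leq_card (subsetIr a T); rewrite Tj.
have : (#|b| <= n)%N by rewrite -[leqRHS]card_ord max_card.
by move: j3 lt_ab; lia.
Qed.

Lemma composite_sign_pm1 n (P : signPattern n) C :
  composite_cycle P C -> composite_sign P C = 1 \/ composite_sign P C = -1.
Proof.
case/andP => /allP CP _; rewrite /composite_sign big_seq.
apply: (big_ind (fun x => x = 1 \/ x = -1)); [by left| |by move=> c /CP/cycle_sign_pm1].
by move=> x y [->|->] [->|->]; rewrite ?mulr1 ?mulrN1 ?opprK; auto.
Qed.

(** In the limit ['X] appears to the power 1, so the coefficient of [X] is the product of the cycle
    factors at 0. The weights [V] themselves are returned so that two of them can be joined by a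
    segment. *)
Lemma coef1_composite (R : realType) n (P : signPattern n) C :
  (0 < n)%N -> composite_cycle P C -> composite_length C = (n - 1)%N ->
  exists2 V : 'M[R]_n, forall i j, 0 < V i j &
    sgz (char_poly (weighted P V))`_1 = (-1) ^+ (n - 1) * composite_sign P C.
Proof.
move=> n0 CP lenC.
set U : 'M[R]_n := \sum_(e <- C) cycle_mx (\matrix_(i, _) (1 : R)) e.
have CPall c : c \in C -> simple_cycle P c by case/andP: CP => /allP + _; apply.
have pE : (char_poly (weighted P U))`_1 = (-1) ^+ (n - 1) * (composite_sign P C)%:~R.
  rewrite char_poly_emphasized // lenC subKn // expr1 coefXM /= -horner_coef0 horner_prod.
  rewrite -lenC /composite_length /composite_sign rmorph_prod /= -prodrXr -big_split /=.
  apply: eq_big_seq => c /CPall/and3P[c0 _ _].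
  rewrite !(hornerM, hornerD, hornerN, hornerXn, hornerC) big1_eq mul1r.
  case: (size c) (size_eq0 c) c0 => [<- //|k _ _].
  by rewrite expr0n sub0r exprS mulN1r mulNr.
have [V [V0 _ Vp]] := @qual_class_near R n P U [::] [:: 1%N] (nonneg_sum_cycle_mx _ (fun=> ler01)).
have sC := composite_sign_pm1 CP.
exists V => //; rewrite -sgz_sgr Vp ?mem_head // pE.
  by rewrite sgz_sgr sgzM sgzX sgzN1; case: sC => ->; rewrite ?rmorphN1 ?sgz1 ?sgzN1.
by rewrite mulf_neq0 ?signr_eq0 ?intr_eq0 //; case: sC => ->.
Qed.

Lemma composite_length2_of_opposite (R : realType) n (P : signPattern n)
    (Psing : sign_singular R P) (PDelta : requires_two_real_eigenvalues R P) C1 C2 :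
  composite_cycle P C1 -> composite_length C1 = (n - 1)%N ->
  composite_cycle P C2 -> composite_length C2 = (n - 1)%N ->
  composite_sign P C1 = - composite_sign P C2 ->
  exists C, composite_cycle P C /\ composite_length C = (n - 2)%N.
Proof.
move=> C1P lenC1 C2P lenC2 opp.
(* For [n = 0] the truncated [n - 2] is 0, the length of the empty composite cycle. *)
have [n0|n0] := posnP n; first by exists [::]; rewrite /composite_length big_nil; split=> //; lia.
have [V1 V1_gt0 sV1] := coef1_composite R n0 C1P lenC1.
have [V2 V2_gt0 sV2] := coef1_composite R n0 C2P lenC2.
have [G GE] := char_poly_line (weighted P V1) (weighted P (V2 - V1)).
have coefE t : (G`_1).[t] = (char_poly (weighted P (V1 + t *: (V2 - V1))))`_1.
  by rewrite weightedD weightedZ GE coef_map.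
have lt0 : (G`_1).[0] * (G`_1).[1] < 0.
  rewrite -sgz_cp0 sgzM !coefE scale0r addr0 scale1r [V1 + _]addrC subrK sV1 sV2 opp.
  by rewrite mulrACA -expr2 sqrr_sign mul1r; case: (composite_sign_pm1 C2P) => ->.
(* The coefficient of [X] has opposite signs at [V1] and [V2], so it vanishes inside the segment,
   whose weights are all positive. *)
have [t /itvP t01 /rootP Gt] := poly_ivtoo ler01 lt0.
have PA : qual_class P (weighted P (V1 + t *: (V2 - V1))).
  apply: weighted_qual_class => i j; rewrite !mxE.
  have := mulr_gt0 (V2_gt0 i j) (_ : 0 < t); rewrite t01 => /(_ isT).
  have := mulr_gt0 (V1_gt0 i j) (_ : 0 < 1 - t); rewrite subr_gt0 t01 => /(_ isT); lra.
rewrite coefE in Gt; have p2 := coef1_coef2_neq0 Psing PDelta PA Gt.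
by have [C [CP lenC _]] := coef_char_poly_composite PA p2; exists C.
Qed.

Theorem theorem5p6 (R : realType) (n : nat) (P : signPattern n)
    (Psing : sign_singular R P) (PDelta : requires_two_real_eigenvalues R P) :
  (* (1) *)
  (forall c : seq 'I_n, simple_cycle P c -> ~~ odd (size c) ->
     0 <= cycle_sign P c) /\
  (* (2) *)
  (forall a b : {set 'I_n}, zero_submatrix P a b ->
     (#|a| + #|b| <= n + 2)%N) /\
  (* (3) *)
  (forall c : seq 'I_n, simple_cycle P c -> odd (size c) ->
     let a := ~: [set i in c] in
     ~ exists d : seq 'I_#|a|, simple_cycle (principal_sub P a) d /\ odd (size d)) /\
  (* (4) *)
  ((~ exists C, composite_cycle P C /\ composite_length C = (n - 1)%N) ->
     (forall c : seq 'I_n, simple_cycle P c ->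
        ~~ odd (size c) /\ 0 <= cycle_sign P c) /\
     (exists C, composite_cycle P C /\ composite_length C = (n - 2)%N)) /\
  (* (5) *)
  ((exists C, composite_cycle P C /\ composite_length C = (n - 1)%N) ->
   (forall C1 C2, composite_cycle P C1 -> composite_length C1 = (n - 1)%N ->
      composite_cycle P C2 -> composite_length C2 = (n - 1)%N ->
      composite_sign P C1 = composite_sign P C2) ->
   forall c1 c2 : seq 'I_n, simple_cycle P c1 -> odd (size c1) ->
     simple_cycle P c2 -> odd (size c2) -> cycle_sign P c1 = cycle_sign P c2) /\
  (* (6) *)
  ((exists C1 C2,
      [/\ composite_cycle P C1, composite_length C1 = (n - 1)%N,
          composite_cycle P C2, composite_length C2 = (n - 1)%N
        & composite_sign P C1 = - composite_sign P C2]) ->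
   exists C, composite_cycle P C /\ composite_length C = (n - 2)%N).
Proof.
split; first by move=> c; apply: (even_cycle_ge0 Psing PDelta).
split; first by move=> a b; apply: (zero_submatrix_le Psing PDelta).
split.
  move=> c cP c_odd a [d [dP d_odd]].
  (* Transported to the vertices of [P], the cycle [d] is an odd cycle disjoint from [c]. *)
  pose d' := map (enum_val : 'I_#|a| -> 'I_n) d.
  have d'P : simple_cycle P d'.
    case/and3P: dP => d0 Ud dP; apply/and3P; split.
    - by rewrite -size_eq0 size_map size_eq0.
    - by rewrite map_inj_uniq //; apply: enum_val_inj.
    - rewrite cycle_map; apply: sub_cycle dP => x y.
      by rewrite /Defs.arc /= mxE.
  have := disjoint_odd_cycles Psing PDelta cP c_odd d'P; rewrite size_map => /(_ d_odd)/negP[].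
  rewrite disjoint_sym disjoint_has; apply/hasPn => _ /mapP[x _ ->].
  by have := enum_valP x; rewrite !inE.
split.
  move=> noC.
  have p1 (A : 'M[R]_n) : qual_class P A -> (char_poly A)`_1 = 0.
    move=> PA; apply/eqP/negPn/negP => /(coef_char_poly_composite PA)[C [CP lenC _]].
    by apply: noC; exists C.
  split=> [c cP|].
    (* An odd cycle would realize a nonzero eigenvalue, but the vanishing coefficient of [X] leaves
       only the eigenvalue 0. *)
    have c_even : ~~ odd (size c).
      apply/negP => /(odd_cycle_root R cP)[A PA [x px xc]].
      move: xc; rewrite (coef1_root_eq0 Psing PDelta PA (p1 A PA) px) sgz0.
      by case: (cycle_sign_pm1 cP) => ->.
    by split=> //; exact: (even_cycle_ge0 Psing PDelta).
  have PA : qual_class P (weighted P (const_mx 1 : 'M[R]_n)).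
    by apply: weighted_qual_class => i j; rewrite mxE.
  have p2 := coef1_coef2_neq0 Psing PDelta PA (p1 _ PA).
  by have [C [CP lenC _]] := coef_char_poly_composite PA p2; exists C.
split.
  move=> _ same c1 c2 c1P c1_odd c2P c2_odd.
  (* Each odd cycle yields a composite cycle of length [n - 1] whose sign is its own up to a factor
     depending only on [n]. *)
  have sgC c : simple_cycle P c -> odd (size c) -> exists C,
      [/\ composite_cycle P C, composite_length C = (n - 1)%N
        & composite_sign P C = - (-1) ^+ (n - 1) * cycle_sign P c].
    move=> cP c_odd; have [A PA p1] := odd_cycle_coef1 Psing PDelta cP c_odd.
    have [|C [CP lenC sC]] := @coef_char_poly_composite _ _ _ _ 1 PA.
      by rewrite -sgz_eq0 p1; case: (cycle_sign_pm1 cP) => ->.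
    by exists C; rewrite sC p1 mulrN mulNr.
  have [C1 [C1P lenC1 sC1]] := sgC c1 c1P c1_odd.
  have [C2 [C2P lenC2 sC2]] := sgC c2 c2P c2_odd.
  have := same _ _ C1P lenC1 C2P lenC2; rewrite sC1 sC2; apply: mulfI.
  by rewrite oppr_eq0 signr_eq0.
case=> C1 [C2 [C1P lenC1 C2P lenC2]].
exact: (composite_length2_of_opposite Psing PDelta).
Qed.
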